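(* For any integers $n\geq m\geq 1$, $\gamma_{tm}(K_{m,n})=m+1$.
   Context: $K_{m,n}$ is the complete bipartite graph with parts of sizes $m$ and $n$. A total mixed dominating set of a finite simple graph $G=(V,E)$ with minimum degree at least $1$ is a set $S\subseteq V\cup E$ such that every element of $V\cup E$ (including those in $S$) is adjacent or incident to an element of $S$ (two vertices are adjacent if joined by an edge; two distinct edges are adjacent if they share an endpoint; a vertex and an edge are incident if the vertex is an endpoint of the edge; no element is adjacent or incident to itself). The total mixed domination number $\gamma_{tm}(G)$ is the minimum cardinality of a total mixed dominating set. *)

(* Defs.v *)
From HB Require Import structures.
From mathcomp Require Import all_boot.

Set Implicit Arguments.
Unset Strict Implicit.
Unset Printing Implicit Defensive.

Record sgraph := SGraph {
  svertex :> finType;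
  sadj : rel svertex;
  sadj_sym : symmetric sadj;
  sadj_irrefl : irreflexive sadj
}.

Definition edge_set (G : sgraph) : {set {set G}} :=
  [set A : {set G} | [exists x : G, exists y : G,
                        sadj x y && (A == [set x; y])]].

Definition edge (G : sgraph) : finType := {A : {set G} | A \in edge_set G}.

(* The elements of V \cup E, as a disjoint sum. *)
Definition mixed (G : sgraph) : finType := (svertex G + edge G)%type.

Definition mixed_adj (G : sgraph) : rel (mixed G) := fun a b =>
  match a, b with
  | inl x, inl y => sadj x y
  | inl x, inr A => x \in val A
  | inr A, inl x => x \in val A
  | inr A, inr B => (A != B) && (val A :&: val B != set0)
  end.

(* "Minimum degree at least 1". *)
Definition no_isolated (G : sgraph) : bool :=
  [forall x : G, exists y : G, sadj x y].

Definition total_mixed_dominating (G : sgraph) (S : {set mixed G}) : bool :=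
  [forall a : mixed G, exists b in S, mixed_adj a b].

(* The full set is the starting candidate of the minimisation. It dominates   *)
(* exactly when G has no isolated vertex (see gamma_tmP); for other graphs    *)
(* there is no dominating set and the value is meaningless.                   *)
Definition gamma_tm (G : sgraph) : nat :=
  #|[arg min_(S < [set: mixed G] | total_mixed_dominating S) #|S| ]|.

Lemma total_mixed_dominatingT (G : sgraph) :
  no_isolated G -> total_mixed_dominating [set: mixed G].
Proof.
move=> /forallP Giso; apply/forallP => -[x | A].
  have /existsP[y xy] := Giso x.
  by apply/existsP; exists (inl y); rewrite in_setT.
have:= valP A; rewrite inE => /existsP[x /existsP[y /andP[_ /eqP defA]]].
by apply/existsP; exists (inl x); rewrite in_setT /= defA !inE eqxx.
Qed.

Lemma gamma_tmP (G : sgraph) : no_isolated G ->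
  (exists2 S : {set mixed G}, total_mixed_dominating S & #|S| = gamma_tm G) /\
  (forall S : {set mixed G}, total_mixed_dominating S -> gamma_tm G <= #|S|).
Proof.
move=> /total_mixed_dominatingT domT; rewrite /gamma_tm.
by case: arg_minnP => // S domS minS; split=> //; exists S.
Qed.

Section CompleteBipartite.
Variables m n : nat.

Definition is_left (x : 'I_m + 'I_n) : bool := if x is inl _ then true else false.

Definition bip_adj : rel ('I_m + 'I_n) := fun x y => is_left x != is_left y.

Lemma bip_adj_sym : symmetric bip_adj.
Proof. by move=> x y; rewrite /bip_adj eq_sym. Qed.

Lemma bip_adj_irrefl : irreflexive bip_adj.
Proof. by move=> x; rewrite /bip_adj eqxx. Qed.

Definition complete_bipartite : sgraph := SGraph bip_adj_sym bip_adj_irrefl.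

Lemma complete_bipartite_no_isolated :
  0 < m -> 0 < n -> no_isolated complete_bipartite.
Proof.
move=> m0 n0; apply/forallP => -[i | j]; apply/existsP.
  by exists (inr (Ordinal n0)).
by exists (inl (Ordinal m0)).
Qed.

End CompleteBipartite.

(* Main.v *)
Require Import Defs.
From mathcomp Require Import all_boot.

(** Upper bound: the [m] vertices of the small part together with one vertex
    of the other part dominate everything, since every edge has an end in the
    small part.

    Lower bound: suppose that [S] is total mixed dominating and [#|S| <= m].
    Let an element occupy the vertices it consists of: itself for a vertex, its
    two ends for an edge.  If each part contained a vertex occupied by no
    element of [S], the edge joining these two vertices would be undominated;
    so [S] occupies a whole part ([exists_occupied_part]).  A part is
    independent, so an element occupies at most one of its vertices; as [S] is
    no larger than the part, the occupation is a bijection between [S] and the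
    part ([tight_occupation]).  This rules out vertices in [S]
    ([only_edges_of_occupied_part]): a vertex of the opposite part occupies
    nothing in this part, and a vertex of this part can then only be dominated
    by an edge of [S] that occupies the same place.  Hence [S] consists of
    edges, and these cover all the vertices of both parts.  The bijection,
    now available on both sides, says that [S] is a perfect matching; but an
    edge of a matching is adjacent to no other edge of it, so it is not
    dominated. *)

Set Implicit Arguments.
Unset Strict Implicit.
Unset Printing Implicit Defensive.

Section Occupation.
Variable G : sgraph.
Implicit Types (x y : G) (a b : mixed G) (X : {set G}) (S : {set mixed G}).

Definition occupied a : {set G} :=
  match a with inl x => [set x] | inr A => val A end.

Definition independent X := {in X &, forall x y, ~~ sadj x y}.

Lemma edge_adj (A : edge G) x y :
  x \in val A -> y \in val A -> x != y -> sadj x y.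
Proof.
have := valP A; rewrite inE => /existsP[u /existsP[v /andP[uv /eqP->]]].
rewrite !inE => /orP[]/eqP-> /orP[]/eqP->; rewrite ?eqxx // => _.
by rewrite sadj_sym.
Qed.

Lemma edge_of_adj x y : sadj x y -> exists A : edge G, val A = [set x; y].
Proof.
move=> xy; have edge_xy : [set x; y] \in edge_set G.
  by rewrite inE; apply/existsP; exists x; apply/existsP; exists y; rewrite xy /=.
by exists (Sub [set x; y] edge_xy); rewrite SubK.
Qed.

Lemma independent_occupied_inj X a x y : independent X ->
  x \in X -> y \in X -> x \in occupied a -> y \in occupied a -> x = y.
Proof.
move=> indX xX yX; case: a => [v | A] /=; first by rewrite !inE => /eqP-> /eqP->.
move=> xA yA; apply/eqP/contraT => neq_xy.
by have := indX x y xX yX; rewrite (edge_adj xA yA neq_xy).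
Qed.

(** Choosing for each vertex of [X] an element of [S] that occupies it is
    injective by independence, hence a bijection from [X] onto [S] by
    cardinality; both conclusions read this bijection backwards. *)
Lemma tight_occupation X S :
  independent X -> #|S| <= #|X| ->
  (forall x, x \in X -> exists2 a, a \in S & x \in occupied a) ->
  (forall a, a \in S -> exists2 x, x \in X & x \in occupied a) /\
  (forall x a b, x \in X -> a \in S -> b \in S ->
     x \in occupied a -> x \in occupied b -> a = b).
Proof.
move=> indX leSX covX.
pose f x : mixed G := odflt (inl x) [pick a in S | x \in occupied a].
have fP x : x \in X -> f x \in S /\ x \in occupied (f x).
  move=> /covX[a aS xa]; rewrite /f; case: pickP => [b /andP[]// | /(_ a)].
  by rewrite aS xa.
have f_inj : {in X &, injective f}.
  move=> x y xX yX fxy; apply: (independent_occupied_inj indX xX yX (a := f x)).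
    by have [] := fP x xX.
  by rewrite fxy; have [] := fP y yX.
have imf : f @: X = S.
  apply/eqP; rewrite eqEcard card_in_imset // leSX andbT.
  by apply/subsetP => _ /imsetP[x xX ->]; have [] := fP x xX.
have f_only x a : x \in X -> a \in S -> x \in occupied a -> a = f x.
  move=> xX; rewrite -imf => /imsetP[y yX ->] xy.
  by have [_ yy] := fP y yX; rewrite (independent_occupied_inj indX xX yX xy yy).
split=> [a | x a b xX aS bS xa xb].
  by rewrite -imf => /imsetP[x xX ->]; exists x => //; have [] := fP x xX.
by rewrite (f_only x a) // (f_only x b).
Qed.

End Occupation.

Section CompleteBipartiteDomination.
Variables m n : nat.
Let K := complete_bipartite m n.
Implicit Types (S : {set mixed K}).

Definition part (c : bool) : {set K} := [set x : K | Defs.is_left x == c].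

Lemma card_part c : #|part c| = if c then m else n.
Proof.
case: c.
  have -> : part true = (@inl 'I_m 'I_n) @: [set: 'I_m].
    apply/setP => -[i | j]; rewrite !inE /=.
      by rewrite imset_f ?inE.
    by apply/esym/negbTE/imsetP => -[].
  by rewrite card_imset ?cardsT ?card_ord // => i j [].
have -> : part false = (@inr 'I_m 'I_n) @: [set: 'I_n].
  apply/setP => -[i | j]; rewrite !inE /=.
    by apply/esym/negbTE/imsetP => -[].
  by rewrite imset_f ?inE.
by rewrite card_imset ?cardsT ?card_ord // => i j [].
Qed.

Lemma independent_part c : independent (part c).
Proof. by move=> x y; rewrite !inE /= /bip_adj => /eqP-> /eqP->; rewrite eqxx. Qed.

(** If [x] and [y] are unoccupied in opposite parts, any element adjacent or
    incident to the edge [xy] would occupy [x] or [y], so [S] misses it. *)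
Lemma exists_occupied_part S : total_mixed_dominating S ->
  exists c, forall x, x \in part c -> exists2 a, a \in S & x \in occupied a.
Proof.
move=> /forallP domS.
pose free x := [forall a in S, x \notin occupied a].
have occ x : ~~ free x -> exists2 a, a \in S & x \in occupied a.
  by case/forall_inPn => a aS /negPn xa; exists a.
have [/existsP[x /andP[xL freex]] | noL] := boolP [exists x in part true, free x];
  last first.
  exists true => x xL; apply: occ; apply: contra noL => freex.
  by apply/existsP; exists x; rewrite xL.
exists false => y yR; apply: occ; apply/negP => freey.
have xy : sadj x y.
  by move: xL yR; rewrite !inE /= /bip_adj => /eqP-> /eqP->.
have [A defA] := edge_of_adj xy.
have [a /andP[aS]] := existsP (domS (inr A)).
have xa := forall_inP freex a aS; have ya := forall_inP freey a aS.
case: a aS xa ya => [v | B] _ /= xa ya; rewrite defA.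
  by move: xa ya; rewrite !inE ![_ == v]eq_sym => /negbTE-> /negbTE->.
case/andP=> _ /set0Pn[z]; rewrite !inE => /andP[/orP[]/eqP-> zB].
  by rewrite zB in xa.
by rewrite zB in ya.
Qed.

(** By tightness every vertex in [S] lies in [part c]. Such a vertex is
    therefore not dominated by a vertex of [S], and an edge of [S] incident to
    it would occupy it a second time. *)
Lemma only_edges_of_occupied_part S c :
  total_mixed_dominating S -> #|S| <= #|part c| ->
  (forall x, x \in part c -> exists2 a, a \in S & x \in occupied a) ->
  forall x : K, inl x \notin S.
Proof.
move=> /forallP domS leS cov x; apply/negP => xS.
have [meet uniqS] := tight_occupation (independent_part (c := c)) leS cov.
have vpart (v : K) : inl v \in S -> v \in part c.
  by case/meet => z zc; rewrite inE => /eqP <-.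
have [a /andP[aS]] := existsP (domS (inl x)).
case: a aS => [y | A] aS /= xa.
  by have := independent_part (vpart _ xS) (vpart _ aS); rewrite /= xa.
by have := uniqS x (inl x) (inr A) (vpart _ xS) xS aS (set11 x) xa.
Qed.

Lemma total_mixed_dominating_gt S : 0 < m -> m <= n ->
  total_mixed_dominating S -> m < #|S|.
Proof.
move=> m_gt0 lemn domS; rewrite ltnNge; apply/negP => leSm.
have leS c : #|S| <= #|part c|.
  by rewrite card_part; case: c => //; apply: leq_trans lemn.
have [c covc] := exists_occupied_part domS.
have no_vertex := only_edges_of_occupied_part domS (leS c) covc.
have cov (x : K) : exists2 a, a \in S & x \in occupied a.
  have [a /andP[aS]] := existsP (forallP domS (inl x)).
  case: a aS => [y | A] aS /= xa; first by rewrite (negbTE (no_vertex y)) in aS.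
  by exists (inr A).
(* [x] lies in one of the two parts, and the occupation is tight on both. *)
have uniqS (x : K) a b : a \in S -> b \in S ->
    x \in occupied a -> x \in occupied b -> a = b.
  have [_ uniqx] := tight_occupation (independent_part (c := Defs.is_left x))
    (leS (Defs.is_left x)) (fun y _ => cov y).
  by apply: uniqx; rewrite inE.
have [a aS _] := cov (inl (Ordinal m_gt0)).
have [b /andP[bS]] := existsP (forallP domS a).
case: a b aS bS => [x | A] [y | B] aS bS /=;
  rewrite ?(negbTE (no_vertex _)) // in aS bS *.
case/andP=> neqAB /set0Pn[z /setIP[zA zB]].
have [eqAB] := uniqS z _ _ aS bS zA zB.
by rewrite eqAB eqxx in neqAB.
Qed.

(** The right vertex [w] is there only to dominate the left vertices; these
    dominate everything else. *)
Lemma exists_total_mixed_dominating_small : 0 < m -> 0 < n ->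
  exists2 S : {set mixed K}, total_mixed_dominating S & #|S| = m.+1.
Proof.
move=> m_gt0 n_gt0; pose w : K := inr (Ordinal n_gt0).
pose S : {set mixed K} := [set inl x | x in w |: part true].
have left_in (i : 'I_m) : inl (inl i) \in S by apply: imset_f; rewrite !inE.
exists S; last first.
  by rewrite card_imset; [rewrite cardsU1 card_part inE | move=> x y []].
apply/forallP => -[[i | j] | A]; apply/existsP.
- by exists (inl w); rewrite andbT; apply: imset_f; rewrite !inE eqxx.
- by exists (inl (inl (Ordinal m_gt0))); rewrite left_in.
have [i iA] : exists i : 'I_m, inl i \in val A.
  have := valP A; rewrite inE => /existsP[x /existsP[y /andP[xy /eqP->]]].
  case: x y xy => [i | j] [i' | j'] //= _; [exists i | exists i'];
    by rewrite !inE eqxx ?orbT.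
by exists (inl (inl i)); rewrite left_in.
Qed.

End CompleteBipartiteDomination.

Theorem proposition3p4 (m n : nat) (hm : 1 <= m) (hmn : m <= n) :
  gamma_tm (complete_bipartite m n) = m + 1.
Proof.
have n_gt0 : 0 < n by apply: leq_trans hmn.
have [[S domS cardS] min_gamma] :=
  gamma_tmP (complete_bipartite_no_isolated hm n_gt0).
have [T domT cardT] := exists_total_mixed_dominating_small hm n_gt0.
apply/eqP; rewrite addn1 eqn_leq -{1}cardT min_gamma //=.
by rewrite -cardS total_mixed_dominating_gt.
Qed.
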